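(* Let $\phi$ be a formula and $\alpha$ a valuation. (i) If the computation tree $[\![\phi]\!]_\alpha$ contains a success leaf labelled with a valuation $\alpha'$, then $\alpha'$ extends $\alpha$ and the universal closure $\forall(\phi^{\alpha'})$ is true in $I$ (in particular the existential closure $\exists(\phi^{\alpha})$ is true in $I$). (ii) If $[\![\phi]\!]_\alpha$ is failed, then $\exists(\phi^{\alpha})$ is false in $I$.
   Context: Fix a first-order language with equality and an interpretation $I$ of it with domain $D$. A valuation is a finite single-valued set of pairs $x/d$ ($x$ a variable, $d\in D$); $\alpha'$ extends $\alpha$ if $\alpha\subseteq\alpha'$. A term $t$ is $\alpha$-closed if all its variables get a value in $\alpha$, and then $t^\alpha\in D$ is its value under $\alpha$; for an expression $E$, $E^\alpha$ is the result of replacing each $\alpha$-closed term $t$ in $E$ by (a name of) $t^\alpha$. A formula is $\alpha$-closed if all its free variables get a value in $\alpha$. An $\alpha$-assignment is an equation $s=t$ one side of which is a variable not assigned by $\alpha$ and the other side an $\alpha$-closed term. $\forall(\chi)$ and $\exists(\chi)$ denote the universal and existential closures of $\chi$. Formulas (no universal quantifier; conjunctions right-associative) are generated by: the empty conjunction $\Box$; $A\wedge\psi$ with $A$ an atom; $(\phi_1\vee\phi_2)\wedge\psi$; $(\phi_1\wedge\phi_2)\wedge\psi$; $(\phi_1\to\phi_2)\wedge\psi$; $\neg\phi\wedge\psi$; $\exists x\,\phi\wedge\psi$, where $\psi,\phi,\phi_1,\phi_2$ are formulas. The computation tree $[\![\phi]\!]_\alpha$ is a finite tree whose root is labelled $(\phi,\alpha)$,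 whose internal nodes are labelled by (formula, valuation) pairs, and whose leaves are labelled $\mathit{error}$, $\mathit{fail}$, or a valuation (a success leaf). It is defined by induction (lexicographically on the size of the formula and the size of its first conjunct): 1. $[\![\Box]\!]_\alpha$: the root has a single child, the success leaf $\alpha$. 2. $[\![A\wedge\psi]\!]_\alpha$, $A$ an atom: if $A$ is $\alpha$-closed and true in $I$ (under $\alpha$), the root's unique subtree is $[\![\psi]\!]_\alpha$; if $A$ is $\alpha$-closed and false, the root's unique child is $\mathit{fail}$; if $A$ is not $\alpha$-closed and not an $\alpha$-assignment, the unique child is $\mathit{error}$; if $A$ is an $\alpha$-assignment $x=t$ or $t=x$ with $x$ not assigned by $\alpha$ and $t$ $\alpha$-closed, the unique subtree is $[\![\psi]\!]_{\alpha\cup\{x/t^\alpha\}}$. 3. $[\![(\phi_1\vee\phi_2)\wedge\psi]\!]_\alpha$: root with two subtrees $[\![\phi_1\wedge\psi]\!]_\alpha$ and $[\![\phi_2\wedge\psi]\!]_\alpha$. 4. $[\![(\phi_1\wedge\phi_2)\wedge\psi]\!]_\alpha$: root with unique subtree $[\![\phi_1\wedge(\phi_2\wedge\psi)]\!]_\alpha$. 5. $[\![(\phi_1\to\phi_2)\wedge\psi]\!]_\alpha$: if $\phi_1$ is $\alpha$-closed and $[\![\phi_1]\!]_\alpha$ has only $\mathit{fail}$ leaves, unique subtree $[\![\psi]\!]_\alpha$; if $\phi_1$ is $\alpha$-closed and $[\![\phi_1]\!]_\alpha$ contains a success leaf, unique subtree $[\![\phi_2\wedge\psi]\!]_\alpha$;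 otherwise unique child $\mathit{error}$. 6. $[\![\neg\phi\wedge\psi]\!]_\alpha$: if $\phi$ is $\alpha$-closed and $[\![\phi]\!]_\alpha$ has only $\mathit{fail}$ leaves, unique subtree $[\![\psi]\!]_\alpha$; if $\phi$ is $\alpha$-closed and $[\![\phi]\!]_\alpha$ contains a success leaf, unique child $\mathit{fail}$; otherwise unique child $\mathit{error}$. 7. $[\![\exists x\,\phi\wedge\psi]\!]_\alpha$, where the bound variable $x$ is (after renaming) fresh, i.e. not in the domain of $\alpha$ and not occurring in $\psi$: unique subtree $[\![\phi\wedge\psi]\!]_\alpha$. A computation tree is failed if it contains only $\mathit{fail}$ leaves. *)

(* Defs.v *)
From Stdlib Require List.
From Stdlib Require Import Classical_Prop.
From mathcomp Require Import all_boot finmap.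

Set Implicit Arguments.
Unset Strict Implicit.
Unset Printing Implicit Defensive.

Local Open Scope fset_scope.
Local Open Scope fmap_scope.

Record language := Language {
  fsym : Type;
  farity : fsym -> nat;
  psym : Type;
  parity : psym -> nat
}.

Inductive term (L : language) :=
| Var of nat
| App (f : fsym L) of 'I_(farity f) -> term L.

Inductive atom (L : language) :=
| Eq of term L & term L
| Rel (p : psym L) of 'I_(parity p) -> term L.

(** [FBox] is the empty conjunction.  Every other constructor is a conjunction
    whose last argument is the second conjunct: for example [FOr phi1 phi2 psi]
    is (phi1 \/ phi2) /\ psi and [FEx x phi psi] is (exists x, phi) /\ psi,
    where x is not bound in psi. *)
Inductive formula (L : language) :=
| FBox
| FAtom of atom L & formula L
| FOr of formula L & formula L & formula L
| FAnd of formula L & formula L & formula L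
| FImp of formula L & formula L & formula L
| FNot of formula L & formula L
| FEx of nat & formula L & formula L.

Arguments Var {L} _.
Arguments App {L} _ _.
Arguments Rel {L} _ _.
Arguments FBox {L}.

Section Syntax.
Variable L : language.
Implicit Types (t : term L) (A : atom L) (phi psi : formula L) (x y z : nat).

(** The conjunction phi /\ psi of two formulas, as an element of the grammar:
    conjunction associates to the right and the empty conjunction is
    neutral, so that for instance (A /\ phi) /\ psi is A /\ (phi /\ psi). *)
Fixpoint fconj phi psi : formula L :=
  match phi with
  | FBox => psi
  | FAtom A phi' => FAtom A (fconj phi' psi)
  | FOr phi1 phi2 phi' => FOr phi1 phi2 (fconj phi' psi)
  | FAnd phi1 phi2 phi' => FAnd phi1 phi2 (fconj phi' psi)
  | FImp phi1 phi2 phi' => FImp phi1 phi2 (fconj phi' psi)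
  | FNot phi1 phi' => FNot phi1 (fconj phi' psi)
  | FEx x phi1 phi' => FEx x phi1 (fconj phi' psi)
  end.

Fixpoint tvars t : {fset nat} :=
  match t with
  | Var x => [fset x]
  | App f args => \bigcup_(i in 'I_(farity f)) tvars (args i)
  end.

Definition avars A : {fset nat} :=
  match A with
  | Eq s t => tvars s `|` tvars t
  | Rel p args => \bigcup_(i in 'I_(parity p)) tvars (args i)
  end.

(** Free and bound occurrences, including binders. *)
Fixpoint vars phi : {fset nat} :=
  match phi with
  | FBox => fset0
  | FAtom A psi => avars A `|` vars psi
  | FOr phi1 phi2 psi | FAnd phi1 phi2 psi | FImp phi1 phi2 psi =>
      vars phi1 `|` vars phi2 `|` vars psi
  | FNot phi1 psi => vars phi1 `|` vars psi
  | FEx x phi1 psi => x |` vars phi1 `|` vars psi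
  end.

Fixpoint fvars phi : {fset nat} :=
  match phi with
  | FBox => fset0
  | FAtom A psi => avars A `|` fvars psi
  | FOr phi1 phi2 psi | FAnd phi1 phi2 psi | FImp phi1 phi2 psi =>
      fvars phi1 `|` fvars phi2 `|` fvars psi
  | FNot phi1 psi => fvars phi1 `|` fvars psi
  | FEx x phi1 psi => (fvars phi1 `\ x) `|` fvars psi
  end.

Fixpoint trename x y t : term L :=
  match t with
  | Var z => Var (if z == x then y else z)
  | App f args => App f (fun i => trename x y (args i))
  end.

Definition arename x y A : atom L :=
  match A with
  | Eq s t => Eq (trename x y s) (trename x y t)
  | Rel p args => Rel p (fun i => trename x y (args i))
  end.

(** Replaces the free occurrences of [x] by [y].  It does not avoid capture, and
    is only used when [y = x] or [y] does not occur in the formula. *)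
Fixpoint rename x y phi : formula L :=
  match phi with
  | FBox => FBox
  | FAtom A psi => FAtom (arename x y A) (rename x y psi)
  | FOr phi1 phi2 psi =>
      FOr (rename x y phi1) (rename x y phi2) (rename x y psi)
  | FAnd phi1 phi2 psi =>
      FAnd (rename x y phi1) (rename x y phi2) (rename x y psi)
  | FImp phi1 phi2 psi =>
      FImp (rename x y phi1) (rename x y phi2) (rename x y psi)
  | FNot phi1 psi => FNot (rename x y phi1) (rename x y psi)
  | FEx z phi1 psi =>
      FEx z (if z == x then phi1 else rename x y phi1) (rename x y psi)
  end.

End Syntax.

(** Universal and existential closures leave the grammar of formulas, which has
    no universal quantifier: they are quantifier prefixes over a formula. *)
Inductive qformula (L : language) :=
| QMatrix of formula L
| QAll of nat & qformula L
| QEx of nat & qformula L.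

Definition all_closure (L : language) (chi : formula L) : qformula L :=
  foldr (@QAll L) (QMatrix chi) (enum_fset (fvars chi)).

Definition ex_closure (L : language) (chi : formula L) : qformula L :=
  foldr (@QEx L) (QMatrix chi) (enum_fset (fvars chi)).

(** The element [dom_pt] witnesses that the domain is nonempty. *)
Record interpretation (L : language) := Interpretation {
  dom : Type;
  dom_pt : dom;
  fint : forall f : fsym L, ('I_(farity f) -> dom) -> dom;
  pint : forall p : psym L, ('I_(parity p) -> dom) -> Prop
}.

Section Semantics.
Variables (L : language) (I : interpretation L).
Implicit Types (v : nat -> dom I).

Fixpoint teval v (t : term L) : dom I :=
  match t with
  | Var x => v x
  | App f args => fint (fun i => teval v (args i))
  end.

Definition aholds v (A : atom L) : Prop :=
  match A with
  | Eq s t => teval v s = teval v t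
  | Rel p args => pint (fun i => teval v (args i))
  end.

Fixpoint holds v (phi : formula L) : Prop :=
  match phi with
  | FBox => True
  | FAtom A psi => aholds v A /\ holds v psi
  | FOr phi1 phi2 psi => (holds v phi1 \/ holds v phi2) /\ holds v psi
  | FAnd phi1 phi2 psi => (holds v phi1 /\ holds v phi2) /\ holds v psi
  | FImp phi1 phi2 psi => (holds v phi1 -> holds v phi2) /\ holds v psi
  | FNot phi1 psi => ~ holds v phi1 /\ holds v psi
  | FEx x phi1 psi =>
      (exists d : dom I, holds [eta v with x |-> d] phi1) /\ holds v psi
  end.

Fixpoint qholds v (Phi : qformula L) : Prop :=
  match Phi with
  | QMatrix chi => holds v chi
  | QAll x Phi' => forall d : dom I, qholds [eta v with x |-> d] Phi'
  | QEx x Phi' => exists d : dom I, qholds [eta v with x |-> d] Phi'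
  end.

Definition true_in (Phi : qformula L) : Prop := forall v, qholds v Phi.
Definition false_in (Phi : qformula L) : Prop := forall v, ~ qholds v Phi.

End Semantics.

(** The language L with a constant, the name of d, for every element d of D. *)
Definition named_language (L : language) (D : Type) : language :=
  {| fsym := fsym L + D;
     farity := fun f => match f with inl g => farity g | inr _ => 0 end;
     psym := psym L;
     parity := @parity L |}.

Definition named_interpretation (L : language) (I : interpretation L) :
    interpretation (named_language L (dom I)) :=
  {| dom := dom I;
     dom_pt := dom_pt I;
     fint := fun f : fsym (named_language L (dom I)) =>
       match f return
         ('I_(@farity (named_language L (dom I)) f) -> dom I) -> dom I with
       | inl g => @fint L I g
       | inr d => fun _ => d
       end;
     pint := @pint L I |}.

Definition valuation (D : Type) := {fmap nat -> D}.

Definition extends (D : Type) (alpha alpha' : valuation D) : Prop :=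
  forall x d, alpha.[? x] = Some d -> alpha'.[? x] = Some d.

Section Valuations.
Variables (L : language) (I : interpretation L).
Implicit Types (alpha : valuation (dom I)) (t : term L) (A : atom L).
Implicit Types (phi : formula L).

Definition term_closed alpha t : bool := tvars t `<=` domf alpha.
Definition atom_closed alpha A : bool := avars A `<=` domf alpha.
Definition formula_closed alpha phi : bool := fvars phi `<=` domf alpha.

(** Values under alpha are only used for alpha-closed expressions, to which the
    default value [dom_pt I] is irrelevant. *)
Definition total_env alpha (x : nat) : dom I := odflt (dom_pt I) alpha.[? x].
Definition tvalue alpha t : dom I := teval (total_env alpha) t.
Definition atrue alpha A : Prop := aholds (total_env alpha) A.

Local Notation NL := (named_language L (dom I)).

Definition name (d : dom I) : term NL :=
  @App NL (inr d) (fun i : 'I_0 => False_rect _ (notF (ltn_ord i))).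

Fixpoint tinst alpha t : term NL :=
  if term_closed alpha t then name (tvalue alpha t) else
  match t with
  | Var x => Var x
  | App f args => @App NL (inl f) (fun i => tinst alpha (args i))
  end.

Definition ainst alpha A : atom NL :=
  match A with
  | Eq s t => Eq (tinst alpha s) (tinst alpha t)
  | Rel p args => @Rel NL p (fun i => tinst alpha (args i))
  end.

(** Only free occurrences of variables are instantiated, hence the restriction
    of [alpha] under a quantifier. *)
Fixpoint inst alpha phi : formula NL :=
  match phi with
  | FBox => FBox
  | FAtom A psi => FAtom (ainst alpha A) (inst alpha psi)
  | FOr phi1 phi2 psi =>
      FOr (inst alpha phi1) (inst alpha phi2) (inst alpha psi)
  | FAnd phi1 phi2 psi =>
      FAnd (inst alpha phi1) (inst alpha phi2) (inst alpha psi)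
  | FImp phi1 phi2 psi =>
      FImp (inst alpha phi1) (inst alpha phi2) (inst alpha psi)
  | FNot phi1 psi => FNot (inst alpha phi1) (inst alpha psi)
  | FEx x phi1 psi => FEx x (inst alpha.[~ x] phi1) (inst alpha psi)
  end.

Definition assigns alpha A (x : nat) t : Prop :=
  (A = Eq (Var x) t \/ A = Eq t (Var x)) /\
  (x \notin domf alpha) /\ term_closed alpha t.

Definition is_assignment alpha A : Prop := exists x t, assigns alpha A x t.

End Valuations.

Inductive leaf (D : Type) := Error | Fail | Success of valuation D.

Inductive tree (L : language) (D : Type) :=
| Leaf of leaf D
| Node of formula L & valuation D & seq (tree L D).

Arguments Error {D}.
Arguments Fail {D}.
Arguments Leaf {L D} _.

Fixpoint leaves (L : language) (D : Type) (T : tree L D) : seq (leaf D) :=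
  match T with
  | Leaf l => [:: l]
  | Node _ _ Ts => flatten (map (@leaves L D) Ts)
  end.

Definition success_leaf (L : language) (D : Type) (alpha' : valuation D)
    (T : tree L D) : Prop :=
  List.In (Success alpha') (leaves T).

Definition successful (L : language) (D : Type) (T : tree L D) : Prop :=
  exists alpha', success_leaf alpha' T.

Definition failed (L : language) (D : Type) (T : tree L D) : Prop :=
  forall l, List.In l (leaves T) -> l = Fail.

Section ComputationTrees.
Variables (L : language) (I : interpretation L).
Local Notation valn := (valuation (dom I)).
Local Notation ctree := (tree L (dom I)).

(** [computation_tree] is a relation and not a function because of [CT_ex]: there [y] is
    the name, possibly [x] itself, given to the bound variable, and the tree is
    only determined up to the choice of these names.  A tree exists for every
    formula and valuation, see [computation_tree_exists] below. *)
Inductive computation_tree : formula L -> valn -> ctree -> Prop :=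
| CT_box alpha :
    computation_tree FBox alpha (Node FBox alpha [:: Leaf (Success alpha)])
| CT_atom_true A psi alpha T :
    atom_closed alpha A -> atrue alpha A ->
    computation_tree psi alpha T ->
    computation_tree (FAtom A psi) alpha (Node (FAtom A psi) alpha [:: T])
| CT_atom_false A psi alpha :
    atom_closed alpha A -> ~ atrue alpha A ->
    computation_tree (FAtom A psi) alpha
      (Node (FAtom A psi) alpha [:: Leaf Fail])
| CT_atom_error A psi alpha :
    ~~ atom_closed alpha A -> ~ is_assignment alpha A ->
    computation_tree (FAtom A psi) alpha
      (Node (FAtom A psi) alpha [:: Leaf Error])
| CT_atom_assign A psi alpha x t T :
    assigns alpha A x t ->
    computation_tree psi alpha.[x <- tvalue alpha t] T ->
    computation_tree (FAtom A psi) alpha (Node (FAtom A psi) alpha [:: T])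
| CT_or phi1 phi2 psi alpha T1 T2 :
    computation_tree (fconj phi1 psi) alpha T1 ->
    computation_tree (fconj phi2 psi) alpha T2 ->
    computation_tree (FOr phi1 phi2 psi) alpha
      (Node (FOr phi1 phi2 psi) alpha [:: T1; T2])
| CT_and phi1 phi2 psi alpha T :
    computation_tree (fconj phi1 (fconj phi2 psi)) alpha T ->
    computation_tree (FAnd phi1 phi2 psi) alpha
      (Node (FAnd phi1 phi2 psi) alpha [:: T])
| CT_imp_failed phi1 phi2 psi alpha T1 T :
    formula_closed alpha phi1 -> computation_tree phi1 alpha T1 -> failed T1 ->
    computation_tree psi alpha T ->
    computation_tree (FImp phi1 phi2 psi) alpha
      (Node (FImp phi1 phi2 psi) alpha [:: T])
| CT_imp_success phi1 phi2 psi alpha T1 T :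
    formula_closed alpha phi1 -> computation_tree phi1 alpha T1 -> successful T1 ->
    computation_tree (fconj phi2 psi) alpha T ->
    computation_tree (FImp phi1 phi2 psi) alpha
      (Node (FImp phi1 phi2 psi) alpha [:: T])
| CT_imp_error phi1 phi2 psi alpha T1 :
    computation_tree phi1 alpha T1 ->
    ~ (formula_closed alpha phi1 /\ (failed T1 \/ successful T1)) ->
    computation_tree (FImp phi1 phi2 psi) alpha
      (Node (FImp phi1 phi2 psi) alpha [:: Leaf Error])
| CT_not_failed phi psi alpha T1 T :
    formula_closed alpha phi -> computation_tree phi alpha T1 -> failed T1 ->
    computation_tree psi alpha T ->
    computation_tree (FNot phi psi) alpha (Node (FNot phi psi) alpha [:: T])
| CT_not_success phi psi alpha T1 :
    formula_closed alpha phi -> computation_tree phi alpha T1 -> successful T1 ->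
    computation_tree (FNot phi psi) alpha
      (Node (FNot phi psi) alpha [:: Leaf Fail])
| CT_not_error phi psi alpha T1 :
    computation_tree phi alpha T1 ->
    ~ (formula_closed alpha phi /\ (failed T1 \/ successful T1)) ->
    computation_tree (FNot phi psi) alpha
      (Node (FNot phi psi) alpha [:: Leaf Error])
| CT_ex x phi psi alpha y T :
    y \notin domf alpha -> y \notin vars psi ->
    (y == x) || (y \notin vars phi) ->
    computation_tree (fconj (rename x y phi) psi) alpha T ->
    computation_tree (FEx x phi psi) alpha (Node (FEx x phi psi) alpha [:: T]).

End ComputationTrees.

Local Close Scope fmap_scope.
Local Close Scope fset_scope.

Fixpoint fsize (L : language) (phi : formula L) : nat :=
  match phi with
  | FBox => 0
  | FAtom _ psi => (fsize psi).+1
  | FOr phi1 phi2 psi | FAnd phi1 phi2 psi | FImp phi1 phi2 psi =>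
      (fsize phi1 + fsize phi2 + fsize psi).+1
  | FNot phi1 psi | FEx _ phi1 psi => (fsize phi1 + fsize psi).+1
  end.

Lemma fsize_conj (L : language) (phi psi : formula L) :
  fsize (fconj phi psi) = fsize phi + fsize psi.
Proof.
by elim: phi => //= [A phi IH|p1 _ p2 _ p IH|p1 _ p2 _ p IH|p1 _ p2 _ p IH|p1 _ p IH
  |x p1 _ p IH]; rewrite IH ?addSn ?addnA.
Qed.

Lemma fsize_rename (L : language) x y (phi : formula L) :
  fsize (rename x y phi) = fsize phi.
Proof.
by elim: phi => //= [A p ->|p1 -> p2 -> p ->|p1 -> p2 -> p ->|p1 -> p2 -> p ->
  |p1 -> p ->|z p1 IH p ->] //; case: ifP; rewrite ?IH.
Qed.

Lemma exists_fresh (A : {fset nat}) : exists y, y \notin A.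
Proof.
exists (\max_(z <- A) z).+1; apply/negP => yA.
by have := @leq_bigmax_seq _ _ xpredT id _ yA isT; rewrite ltnn.
Qed.

Lemma computation_tree_exists (L : language) (I : interpretation L)
    (phi : formula L) (alpha : valuation (dom I)) :
  exists T, computation_tree phi alpha T.
Proof.
have [n] := ubnP (fsize phi); elim: n phi alpha => // n IH phi alpha.
case: phi => /= [|A psi|p1 p2 psi|p1 p2 psi|p1 p2 psi|p psi|x p psi].
- by move=> _; eexists; apply: CT_box.
- rewrite ltnS => lt_n; case: (boolP (atom_closed alpha A)) => clA.
    have [hA|hA] := classic (atrue alpha A); last by eexists; apply: CT_atom_false.
    by have [T hT] := IH _ alpha lt_n; eexists; apply: CT_atom_true hT.
  have [[x [t hA]]|hA] := classic (is_assignment alpha A).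
    have [T hT] := IH _ alpha.[x <- tvalue alpha t]%fmap lt_n.
    by eexists; apply: CT_atom_assign hA hT.
  by eexists; apply: CT_atom_error.
- rewrite ltnS => lt_n.
  have [|T1 hT1] := IH (fconj p1 psi) alpha.
    by rewrite fsize_conj (leq_ltn_trans _ lt_n)// leq_add2r leq_addr.
  have [|T2 hT2] := IH (fconj p2 psi) alpha.
    by rewrite fsize_conj (leq_ltn_trans _ lt_n)// leq_add2r leq_addl.
  by eexists; apply: CT_or hT1 hT2.
- rewrite ltnS => lt_n.
  have [|T hT] := IH (fconj p1 (fconj p2 psi)) alpha.
    by rewrite !fsize_conj addnA.
  by eexists; apply: CT_and hT.
- rewrite ltnS => lt_n.
  have [|T1 hT1] := IH p1 alpha.
    by rewrite (leq_ltn_trans _ lt_n)// -addnA leq_addr.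
  have [|T hT] := IH psi alpha; first by rewrite (leq_ltn_trans _ lt_n)// leq_addl.
  have [|T2 hT2] := IH (fconj p2 psi) alpha.
    by rewrite fsize_conj (leq_ltn_trans _ lt_n)// leq_add2r leq_addl.
  have [[cl [hf|hs]]|he] :=
    classic (formula_closed alpha p1 /\ (failed T1 \/ successful T1)).
  + by eexists; apply: CT_imp_failed hT1 hf hT.
  + by eexists; apply: CT_imp_success hT1 hs hT2.
  + by eexists; apply: CT_imp_error hT1 he.
- rewrite ltnS => lt_n.
  have [|T1 hT1] := IH p alpha; first by rewrite (leq_ltn_trans _ lt_n)// leq_addr.
  have [|T hT] := IH psi alpha; first by rewrite (leq_ltn_trans _ lt_n)// leq_addl.
  have [[cl [hf|hs]]|he] :=
    classic (formula_closed alpha p /\ (failed T1 \/ successful T1)).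
  + by eexists; apply: CT_not_failed hT1 hf hT.
  + by eexists; apply: CT_not_success hT1 hs.
  + by eexists; apply: CT_not_error hT1 he.
- rewrite ltnS => lt_n.
  have [y] := exists_fresh (domf alpha `|` vars psi `|` vars p)%fset.
  rewrite !in_fsetU !negb_or => /andP[/andP[y1 y2] y3].
  have [|T hT] := IH (fconj (rename x y p) psi) alpha.
    by rewrite fsize_conj fsize_rename.
  by eexists; apply: (CT_ex y1 y2 _ hT); rewrite y3 orbT.
Qed.

(* Main.v *)
(** Both parts are read semantically: the variable assignment v agrees with the
    valuation alpha if v x = d for every pair x/d in alpha, and phi^alpha holds
    at v iff phi holds at v overridden by alpha.  An induction on the tree then
    shows simultaneously that phi holds at every v agreeing with the label of a
    success leaf and that, when the tree is failed, phi holds at no v agreeing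
    with alpha.  The two parts have to be proved together, since negation and
    implication exchange them; there the alpha-closedness of the tested formula
    makes its truth value the same at all v agreeing with alpha. *)
From Stdlib Require Import FunctionalExtensionality.
Require Import Defs.
From mathcomp Require Import all_boot finmap.

Set Implicit Arguments.
Unset Strict Implicit.
Unset Printing Implicit Defensive.

Local Open Scope fset_scope.
Local Open Scope fmap_scope.

(** * Dependence of truth on free variables, and renaming *)

Section Coincidence.
Variables (L : language) (I : interpretation L).
Implicit Types (t : term L) (A : atom L) (phi psi : formula L).
Implicit Types (v w : nat -> dom I).

Lemma eq_teval v w t : {in tvars t, v =1 w} -> teval v t = teval w t.
Proof.
elim: t => [x|f args IH] /= vw; first by apply: vw; rewrite inE.
congr fint; apply: functional_extensionality => i; apply: IH => x xi.
by apply: vw; apply/bigfcupP; exists i; rewrite ?mem_index_enum.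
Qed.

Lemma eq_aholds v w A : {in avars A, v =1 w} -> aholds v A = aholds w A.
Proof.
case: A => [s t|p args] /= vw.
  by rewrite !(@eq_teval v w) // => x xt; apply: vw; rewrite inE xt ?orbT.
congr pint; apply: functional_extensionality => i; apply: eq_teval => x xi.
by apply: vw; apply/bigfcupP; exists i; rewrite ?mem_index_enum.
Qed.

(** An equality of propositions, so that it can be rewritten with. Both sides have the same shape
    and differ only in values of terms, hence functional extensionality suffices. *)
Lemma eq_holds phi v w : {in fvars phi, v =1 w} -> holds v phi = holds w phi.
Proof.
elim: phi v w => //=
  [A psi IH|p1 IH1 p2 IH2 psi IH|p1 IH1 p2 IH2 psi IH|p1 IH1 p2 IH2 psi IH
  |p1 IH1 psi IH|x p1 IH1 psi IH] v w vw; rewrite (IH v w); last 1 first.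
  1,3,5,7,9,11: by move=> z zp; apply: vw; rewrite !inE zp ?orbT.
- by rewrite (@eq_aholds v w) // => z zA; apply: vw; rewrite inE zA.
all: try by rewrite (IH1 v w) ?(IH2 v w) // => z zp; apply: vw;
  rewrite !inE zp ?orbT.
congr (ex _ /\ _); apply: functional_extensionality => d.
apply: IH1 => z zp /=; case: eqP => // /eqP zx.
by apply: vw; rewrite !inE zx zp.
Qed.

Lemma holds_fconj v phi psi :
  holds v (fconj phi psi) <-> holds v phi /\ holds v psi.
Proof. by elim: phi => /=; tauto. Qed.

(** Freshness of a bound name is expressed with [vars], coincidence with [fvars]; this links the
    two. *)
Lemma fvars_sub_vars phi : fvars phi `<=` vars phi.
Proof.
elim: phi => //= [A psi IH|p1 IH1 p2 IH2 psi IH|p1 IH1 p2 IH2 psi IH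
  |p1 IH1 p2 IH2 psi IH|p1 IH1 psi IH|x p1 IH1 psi IH]; rewrite ?fsetUSS //.
by apply: fsubset_trans (fsubsetDl _ _) (fsubset_trans IH1 (fsubsetUr _ _)).
Qed.

Lemma teval_rename v x y t :
  teval v (trename x y t) = teval [eta v with x |-> v y] t.
Proof.
elim: t => [z|f args IH] /=; first by case: eqP.
by congr fint; apply: functional_extensionality => i; apply: IH.
Qed.

Lemma aholds_rename v x y A :
  aholds v (arename x y A) = aholds [eta v with x |-> v y] A.
Proof.
case: A => [s t|p args] /=; first by rewrite !teval_rename.
by congr pint; apply: functional_extensionality => i; apply: teval_rename.
Qed.

Lemma holds_rename phi v x y : (y == x) || (y \notin vars phi) ->
  holds v (rename x y phi) = holds [eta v with x |-> v y] phi.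
Proof.
elim: phi v => //=
  [A psi IH|p1 IH1 p2 IH2 psi IH|p1 IH1 p2 IH2 psi IH|p1 IH1 p2 IH2 psi IH
  |p1 IH1 psi IH|z p1 IH1 psi IH] v; rewrite !inE ?negb_or => y_ok;
  rewrite IH; last 1 first.
  1,3,5,7,9,11: by case: (y == x) y_ok => //= /andP[].
- by rewrite aholds_rename.
all: try by rewrite IH1 ?IH2 //; case: (y == x) y_ok => //=;
  rewrite -andbA => /and3P[].
- by rewrite IH1 //; case: (y == x) y_ok => //= /andP[].
congr (ex _ /\ _); apply: functional_extensionality => d.
case: eqP => [->|/eqP zx].
  (* The binder is [x] itself: renaming stops there, and the inner update at [x] hides the outer
     one. *)
  by apply: eq_holds => u _ /=; case: eqP.
rewrite IH1; last by case: (y == x) y_ok => //= /andP[/andP[]].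
apply: eq_holds => u _ /=.
(* No capture: either [y] is [x], which differs from [z], or [y] avoids [vars], which contains the
   binder [z]. *)
have /negPf -> : y != z.
  by case: eqP y_ok => [->|_] /=; [rewrite eq_sym | case/andP=> /andP[]].
by case: eqP => // ->; rewrite eq_sym (negPf zx).
Qed.

End Coincidence.

(** * Truth of universal and existential closures *)

Section Closures.
Variables (L : language) (I : interpretation L).
Implicit Types (chi : formula L) (v w : nat -> dom I).

Lemma true_all_closure chi : (forall v, holds v chi) ->
  true_in I (all_closure chi).
Proof.
move=> h; rewrite /true_in /all_closure.
by elim: (enum_fset _) => //= x s IH v d; apply: IH.
Qed.

Lemma holds_ex_closure v w chi : holds w chi -> qholds v (ex_closure chi).
Proof.
move=> h; rewrite /ex_closure.
(* Invariant along the prefix: [v] and [w] agree on the free variables no longer waiting to be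
   quantified. It is vacuous for the full list, and the witness [w x] preserves it. *)
have: {in fvars chi, forall x, x \notin enum_fset (fvars chi) -> v x = w x}.
  by move=> x xf; rewrite xf.
elim: (enum_fset _) v => /= [v vw|x s IH v vw].
  by rewrite (@eq_holds _ _ _ v w) // => x xf; apply: vw.
exists (w x); apply: IH => z zf zs /=.
by case: eqP => [->//|/eqP zx]; apply: vw; rewrite ?inE ?negb_or ?zx.
Qed.

Lemma qholds_ex_closure v chi : qholds v (ex_closure chi) ->
  exists w, holds w chi.
Proof.
rewrite /ex_closure; elim: (enum_fset _) v => /= [v|x s IH v [d /IH //]].
by exists v.
Qed.

End Closures.

(** * Valuations, variable assignments and instances *)

Section Instances.
Variables (L : language) (I : interpretation L).
Implicit Types (alpha : valuation (dom I)) (v : nat -> dom I).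

Definition agrees v alpha := forall x d, alpha.[? x] = Some d -> v x = d.

Definition override v alpha (x : nat) : dom I := odflt (v x) alpha.[? x].

Lemma agrees_override v alpha : agrees (override v alpha) alpha.
Proof. by rewrite /override => x d ->. Qed.

Lemma agrees_extends v alpha alpha' :
  extends alpha alpha' -> agrees v alpha' -> agrees v alpha.
Proof. by move=> ext va x d /ext /va. Qed.

(** On the domain of [alpha] the default value in [total_env] is never reached. *)
Lemma agrees_total_env v alpha : agrees v alpha ->
  {in domf alpha, total_env (I := I) alpha =1 v}.
Proof.
by move=> va x xa; rewrite /total_env (in_fnd xa) /= (va _ _ (in_fnd xa)).
Qed.

Lemma tvalue_agrees v alpha (t : term L) : agrees v alpha ->
  term_closed alpha t -> tvalue alpha t = teval v t.
Proof.
by move=> va /fsubsetP cl; apply: eq_teval => x /cl /(agrees_total_env va).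
Qed.

Lemma atrue_agrees v alpha (A : atom L) : agrees v alpha ->
  atom_closed alpha A -> atrue alpha A = aholds v A.
Proof.
by move=> va /fsubsetP cl; apply: eq_aholds => x /cl /(agrees_total_env va).
Qed.

Lemma holds_agrees v w alpha (phi : formula L) : agrees v alpha ->
  agrees w alpha -> formula_closed alpha phi -> holds v phi = holds w phi.
Proof.
move=> va wa /fsubsetP cl; apply: eq_holds => x /cl xa.
by rewrite -(agrees_total_env va) ?(agrees_total_env wa).
Qed.

Local Notation NI := (named_interpretation I).

(** A closed subterm becomes a name of the value that every assignment agreeing with [alpha] gives
    it; a variable outside [alpha] keeps its value under [v]. *)
Lemma teval_tinst (v : nat -> dom NI) alpha (t : term L) :
  teval v (tinst alpha t) = teval (I := I) (override v alpha) t.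
Proof.
elim: t => [x|f args IH] /=; case: ifP => cl;
  try exact: tvalue_agrees (@agrees_override v alpha) cl.
  have xa : x \notin domf alpha by rewrite -fsub1set; exact: negbT cl.
  by rewrite /override not_fnd.
by congr fint; apply: functional_extensionality => i; apply: IH.
Qed.

Lemma aholds_ainst (v : nat -> dom NI) alpha (A : atom L) :
  aholds v (ainst alpha A) = aholds (I := I) (override v alpha) A.
Proof.
case: A => [s t|p args] /=; first by rewrite !teval_tinst.
by congr pint; apply: functional_extensionality => i; apply: teval_tinst.
Qed.

Lemma holds_inst (phi : formula L) (v : nat -> dom NI) alpha :
  holds v (inst alpha phi) = holds (I := I) (override v alpha) phi.
Proof.
elim: phi v alpha => //=
  [A psi IH|p1 IH1 p2 IH2 psi IH|p1 IH1 p2 IH2 psi IH|p1 IH1 p2 IH2 psi IH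
  |p1 IH1 psi IH|x p1 IH1 psi IH] v alpha;
  rewrite ?IH ?IH1 ?IH2 ?aholds_ainst //.
congr (ex _ /\ _); apply: functional_extensionality => d.
(* Removing [x] from [alpha] lets the quantified value [d] prevail at [x]; the other variables are
   overridden as before. *)
rewrite IH1; apply: eq_holds => z _ /=.
by rewrite /override fnd_rem1 /=; case: eqP.
Qed.

End Instances.

(** * Soundness by induction on computation trees *)

Section Soundness.
Variables (L : language) (I : interpretation L).
Implicit Types (alpha : valuation (dom I)) (T : tree L (dom I)).
Implicit Types (phi psi : formula L).

Lemma In_cat (X : Type) (a : X) s1 s2 :
  List.In a (s1 ++ s2) <-> List.In a s1 \/ List.In a s2.
Proof. by elim: s1 => /=; tauto. Qed.

Lemma success_leaf1 phi alpha alpha' T :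
  success_leaf alpha' (Node phi alpha [:: T]) -> success_leaf alpha' T.
Proof. by rewrite /success_leaf /= cats0. Qed.

Lemma failed1 phi alpha T : failed (Node phi alpha [:: T]) -> failed T.
Proof. by rewrite /failed /= cats0. Qed.

Lemma extends_set alpha x d : x \notin domf alpha -> extends alpha alpha.[x <- d].
Proof.
move=> xa z e; rewrite fnd_set; case: eqP => // ->.
by rewrite not_fnd.
Qed.

Lemma agrees_set (v : nat -> dom I) alpha x :
  agrees v alpha -> agrees v alpha.[x <- v x].
Proof. by move=> va z d; rewrite fnd_set; case: eqP => [-> [] //|_ /va]. Qed.

Lemma computation_tree_sound phi alpha T : computation_tree phi alpha T ->
  (forall alpha', success_leaf alpha' T -> extends alpha alpha' /\
     forall v : nat -> dom I, agrees v alpha' -> holds v phi) /\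
  (failed T -> forall v : nat -> dom I, agrees v alpha -> ~ holds v phi).
Proof.
elim=> {phi alpha T}.
- move=> alpha; split=> [alpha' [[->]|[]]|/(_ _ (or_introl erefl)) //].
  by split.
- move=> A psi alpha T cl hA _ [IHs IHf]; split.
    move=> alpha' /success_leaf1 /IHs[ext h]; split=> // v va /=.
    split; last exact: h.
    by rewrite -(atrue_agrees (agrees_extends ext va) cl).
  by move=> /failed1 /IHf h v /h nh [].
- move=> A psi alpha cl hA; split=> [alpha' [//|[]]|_ v va [hv _]].
  by apply: hA; rewrite (atrue_agrees va cl).
(* An error leaf is neither a success nor [Fail], so both claims are vacuous. *)
- by move=> A psi alpha _ _; split=> [alpha' [//|[]]|/(_ _ (or_introl erefl))].
- move=> A psi alpha x t T [At [xa cl]] _ [IHs IHf].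
  (* Where [alpha] is respected, the equation says exactly that [x] has the value being assigned. *)
  have holdsA v : agrees v alpha -> aholds v A <-> v x = tvalue alpha t.
    by move=> va; rewrite (tvalue_agrees va cl); case: At => -> /=; split.
  split.
    move=> alpha' /success_leaf1 /IHs[ext h].
    have ext' : extends alpha alpha' by move=> z d /(extends_set _ xa) /ext.
    split=> // v va /=; split; last exact: h.
    apply/holdsA; first exact: agrees_extends va.
    by apply: va; apply: ext; rewrite fnd_set eqxx.
  (* Truth of the equation at [v] makes [v] agree with the enlarged valuation too, where [psi] is
     refuted. *)
  move=> /failed1 /IHf h v va [/holdsA-/(_ va) vx]; apply: h.
  by rewrite -vx; apply: agrees_set.
- move=> p1 p2 psi alpha T1 T2 _ [IHs1 IHf1] _ [IHs2 IHf2]; split.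
    move=> alpha'; rewrite /success_leaf /= cats0 => /In_cat.
    by case=> [/IHs1|/IHs2] [ext h]; split=> // v /h /holds_fconj /=; tauto.
  move=> hf v va /= [h12 hpsi].
  have hf1 : failed T1 by move=> l hl; apply: hf => /=; apply/In_cat; left.
  have hf2 : failed T2.
    by move=> l hl; apply: hf => /=; rewrite cats0; apply/In_cat; right.
  case: h12 => h; [apply: (IHf1 hf1 v va)|apply: (IHf2 hf2 v va)];
    exact/holds_fconj.
- move=> p1 p2 psi alpha T _ [IHs IHf]; split.
    move=> alpha' /success_leaf1 /IHs[ext h]; split=> // v /h.
    by rewrite /= !holds_fconj; tauto.
  by move=> /failed1 /IHf h v /h; rewrite /= !holds_fconj; tauto.
(* By [n1], [p1] is false wherever [alpha] is respected, so the implication is vacuously true. *)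
- move=> p1 p2 psi alpha T1 T cl _ [_ IH1] /IH1 n1 _ [IHs IHf]; split.
    move=> alpha' /success_leaf1 /IHs[ext h]; split=> // v va /=.
    by split; [move/n1: (agrees_extends ext va) | apply: h].
  by move=> /failed1 /IHf h v /h nh [].
- move=> p1 p2 psi alpha T1 T cl _ [IH1 _] [beta /IH1[ext1 h1]] _ [IHs IHf].
  split.
    move=> alpha' /success_leaf1 /IHs[ext h]; split=> // v /h /holds_fconj /=.
    tauto.
  move=> /failed1 /IHf h v va /= [h12 hpsi]; apply: (h v va); apply/holds_fconj.
  split=> //; apply: h12.
  (* The success leaf gives [p1] at assignments agreeing with [beta], as [v] need not. Overriding
     [v] by [beta] yields one that also agrees with [alpha]; closedness of [p1] carries its truth
     back to [v]. *)
  have wb := @agrees_override L I v beta.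
  by rewrite (holds_agrees va (agrees_extends ext1 wb) cl); apply: h1.
- move=> p1 p2 psi alpha T1 _ _ _.
  by split=> [alpha' [//|[]]|/(_ _ (or_introl erefl))].
- move=> p psi alpha T1 T cl _ [_ IH1] /IH1 n1 _ [IHs IHf]; split.
    move=> alpha' /success_leaf1 /IHs[ext h]; split=> // v va /=.
    by split; [apply: n1; apply: agrees_extends va | apply: h].
  by move=> /failed1 /IHf h v /h nh [].
- move=> p psi alpha T1 cl _ [IH1 _] [beta /IH1[ext1 h1]].
  split=> [alpha' [//|[]]|_ v va /= [np _]]; apply: np.
  (* The same transfer as for implication. *)
  have wb := @agrees_override L I v beta.
  by rewrite (holds_agrees va (agrees_extends ext1 wb) cl); apply: h1.
- move=> p psi alpha T1 _ _ _.
  by split=> [alpha' [//|[]]|/(_ _ (or_introl erefl))].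
- move=> x p psi alpha y T ya ypsi yp _ [IHs IHf]; split.
    move=> alpha' /success_leaf1 /IHs[ext h]; split=> // v /h /holds_fconj /=.
    by rewrite holds_rename // => -[hp hpsi]; split=> //; exists (v y).
  move=> /failed1 /IHf h v va /= [[d hd] hpsi].
  (* The witness [d] is stored at [y], which is fresh for [alpha] and [psi]: agreement and the truth
     of [psi] survive. *)
  apply: (h [eta v with y |-> d]).
    move=> z e za /=; case: eqP => [zy|_]; last exact: va.
    by rewrite zy not_fnd in za.
  apply/holds_fconj; split.
    rewrite holds_rename //.
    rewrite (@eq_holds _ _ _ _ [eta v with x |-> d]) // => z zp /=; rewrite eqxx.
    case: eqP => // /eqP zx; case: eqP => // zy.
    (* A free variable of [p] equal to [y] can only be [x]. *)
    move: yp; rewrite -zy (negPf zx) /=.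
    by rewrite (fsubsetP (fvars_sub_vars p) _ zp).
  rewrite (@eq_holds _ _ _ _ v) // => z zpsi /=; case: eqP => // zy.
  by rewrite -zy (fsubsetP (fvars_sub_vars psi) _ zpsi) in ypsi.
Qed.

End Soundness.

Theorem theorem1 (L : language) (I : interpretation L) (phi : formula L)
    (alpha : valuation (dom I)) (T : tree L (dom I))
    (hT : computation_tree phi alpha T) :
  (forall alpha' : valuation (dom I), success_leaf alpha' T ->
     extends alpha alpha' /\
     true_in (named_interpretation I) (all_closure (inst alpha' phi)) /\
     true_in (named_interpretation I) (ex_closure (inst alpha phi))) /\
  (failed T ->
     false_in (named_interpretation I) (ex_closure (inst alpha phi))).
Proof.
have [sound_s sound_f] := computation_tree_sound hT; split.
  move=> alpha' /sound_s[ext h]; split=> //; split.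
    by apply: true_all_closure => v; rewrite holds_inst; apply/h/agrees_override.
  (* Witnesses come from [alpha'], with [v] as default elsewhere. Overriding again by [alpha]
     changes nothing on the domain of [alpha'], since [alpha'] extends [alpha]. *)
  move=> v; apply: (@holds_ex_closure _ _ _ (override v alpha')).
  rewrite holds_inst; apply/h => x d xd; rewrite /override.
  by case E: alpha.[? x] => [e|] /=; rewrite ?xd //; move: (ext _ _ E);
    rewrite xd => -[].
move=> /sound_f nh v /qholds_ex_closure[w]; rewrite holds_inst.
exact/nh/agrees_override.
Qed.
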